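(* Let $L>0$, $\mu\in(-\infty,0)$, $\kappa:=\mu/L$, let $N$ be a positive integer, let $\gamma>0$ with $\gamma L\in(1,\overline{\gamma L}_N(\kappa))$, and let $\bar N:=\max\{k\in\mathbb{N}: T_k(\gamma L,\kappa)\ge0\}$. Put $$P:=\frac{(2-\gamma L)(2-\gamma\mu)}{2-\gamma L-\gamma\mu}(N-\bar N)+\frac{\frac{E_{\bar N}(1-\gamma L)}{1-(1-\gamma L)^2}-\frac{E_{\bar N}(1-\gamma\mu)}{1-(1-\gamma\mu)^2}}{\frac1{1-(1-\gamma L)^2}-\frac1{1-(1-\gamma\mu)^2}} .$$ Then there exist $d\ge1$, $f:\mathbb{R}^d\to\mathbb{R}$ in $\mathcal{F}_{\mu,L}$ bounded below and $x_0\in\mathbb{R}^d$ with $f(x_0)>f_*:=\inf_xf(x)$ such that the iterates $x_{i+1}=x_i-\gamma\nabla f(x_i)$, $i=0,\dots,N-1$, satisfy $$\frac1{2L}\min_{0\le i\le N}\{\|\nabla f(x_i)\|^2\}=\frac{f(x_0)-f_*}{1+\gamma L\,P}$$ together with $$\frac1{2L}\min_{0\le i\le N}\{\|\nabla f(x_i)\|^2\}=\frac{f(x_0)-f(x_N)}{\gamma L\,P}.$$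
   Context: For $L\in(0,\infty)$ and $\mu\in(-\infty,L)$, $\mathcal{F}_{\mu,L}$ is the class of functions $f:\mathbb{R}^d\to\mathbb{R}$ such that both $\frac{L}{2}\|\cdot\|^2-f$ and $f-\frac{\mu}{2}\|\cdot\|^2$ are convex ($\|\cdot\|$ Euclidean norm; such functions are differentiable). For an integer $k\ge0$ let $E_k(x):=\sum_{j=1}^{2k}x^{-j}$, $x\in\mathbb{R}\setminus\{0\}$ (so $E_0=0$), and for $\ell\in(1,2)$ let $T_k(\ell,\kappa):=E_k(1-\kappa\ell)-E_k(1-\ell)$ (so $T_0=0$; here $0\in\mathbb{N}$). For $\kappa<0$ and $k\ge1$, $\overline{\gamma L}_k(\kappa)$ denotes the unique root $\ell\in(1,2)$ of $T_k(\ell,\kappa)=0$. *)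

(* Defs.v *)
From HB Require Import structures.
From mathcomp Require Import all_boot all_order all_algebra.
From mathcomp Require Import all_classical all_reals all_analysis.

Set Implicit Arguments.
Unset Strict Implicit.
Unset Printing Implicit Defensive.

Import Order.TTheory GRing.Theory Num.Theory.
Import numFieldNormedType.Exports.

Local Open Scope classical_set_scope.
Local Open Scope ring_scope.

(* The library norm `|x| on 'rV[R]_d is the sup norm, hence this definition. *)
Definition enorm (R : realType) (d : nat) (x : 'rV[R]_d) : R :=
  Num.sqrt (\sum_(i < d) x 0 i ^+ 2).

(* The coordinates of the differential in the canonical basis; meaningful
   where f is differentiable, which holds everywhere for f in Fclass mu L. *)
Definition grad (R : realType) (d : nat) (f : 'rV[R]_d -> R) (x : 'rV[R]_d) :
    'rV[R]_d :=
  \row_(i < d) 'd f x (delta_mx 0 i).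

Definition Fclass (R : realType) (d : nat) (mu L : R) (f : 'rV[R]_d -> R) :
    Prop :=
  convex_function [set: 'rV[R]_d] (fun x => L / 2 * enorm x ^+ 2 - f x) /\
  convex_function [set: 'rV[R]_d] (fun x => f x - mu / 2 * enorm x ^+ 2).

Definition gd (R : realType) (d : nat) (f : 'rV[R]_d -> R) (gamma : R)
    (x0 : 'rV[R]_d) (i : nat) : 'rV[R]_d :=
  iter i (fun x => x - gamma *: grad f x) x0.

Definition Efun (R : realType) (k : nat) (x : R) : R :=
  \sum_(1 <= j < k.*2.+1) x ^- j.

Definition Tfun (R : realType) (k : nat) (l kappa : R) : R :=
  Efun k (1 - kappa * l) - Efun k (1 - l).

(* "The" root: get picks an element of the set, which is a singleton when
   kappa < 0 and 0 < k. *)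
Definition gLbar (R : realType) (k : nat) (kappa : R) : R :=
  get [set l : R | 1 < l < 2 /\ Tfun k l kappa = 0].

(* The largest element of A; arbitrary if A has none. *)
Definition nat_max (A : set nat) : nat := get (A `&` ubound A).

Definition Nbar (R : realType) (l kappa : R) : nat :=
  nat_max [set k | 0 <= Tfun k l kappa].

Definition Prate (R : realType) (L mu gamma : R) (N Nb : nat) : R :=
  (2 - gamma * L) * (2 - gamma * mu) / (2 - gamma * L - gamma * mu)
    * (N%:R - Nb%:R)
  + (Efun Nb (1 - gamma * L) / (1 - (1 - gamma * L) ^+ 2)
     - Efun Nb (1 - gamma * mu) / (1 - (1 - gamma * mu) ^+ 2))
    / ((1 - (1 - gamma * L) ^+ 2)^-1 - (1 - (1 - gamma * mu) ^+ 2)^-1).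

(* Main.v *)
Require Import Defs.
From HB Require Import structures.
From mathcomp Require Import all_boot all_order all_algebra.
From mathcomp Require Import all_classical all_reals all_analysis.
From mathcomp Require Import ring lra.

Set Implicit Arguments.
Unset Strict Implicit.
Unset Printing Implicit Defensive.

Import Order.TTheory GRing.Theory Num.Theory.
Import numFieldNormedType.Exports.

Local Open Scope classical_set_scope.
Local Open Scope ring_scope.

(** Write [rho = 1 - gamma L], in [(-1, 0)], and [eta = 1 - gamma mu > 1].  A
    function of the class with prescribed values [F i] and gradients [g i] at
    points [x i] exists as soon as, for all [i] and [j], the paraboloid of
    curvature [mu] through the data at [j] lies below the one of curvature [L]
    through the data at [i]: the largest [mu]-convex minorant of the upper
    paraboloids does it ([interpolation]).  Constants are [mu]-convex because
    [mu <= 0], so the infimum of this function is the least vertex value of the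
    upper paraboloids.  It remains to choose the gradients.

    Split [g k = u k + v k] with [g k.+1 = rho u k + eta v k]: between [x k] and
    [x k.+1] the function looks like a quadratic with curvature [L] along [u k]
    and [mu] along [v k].  The centres of the upper paraboloids then move along
    the [v k] and those of the lower ones along the [u k], so that the minimal
    height of upper paraboloid [i] above lower paraboloid [j] is, up to a
    positive factor, a sum of inner products [dot (u k) (v l)].  The chain is
    interpolable if these vanish for [k <= l] and have nonnegative partial sums
    over [k > l] ([chain_interpolable]).

    During the first [Nb] steps the two directions stay fixed: the data are those of
    a quadratic function.  The masses of [u] and [v] at step [Nb] are such that [g]
    has norm 1 both before and after the next step.  From then on every step
    turns the frame into a fresh dimension so as to restore the two masses: [g]
    becomes an autoregressive sequence with characteristic roots [rho] and
    [eta^-1], whose inner products satisfy the two conditions ([frame_orth],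
    [frame_uv_sum_ge0]) and whose norm stays 1.  Before step [Nb] the norm is at
    least 1.  Hence the minimal gradient norm is 1, the decrease over [N] steps
    sums up to [gamma / 2 * P] ([frame_total], [Prate_mass]), and the infimum is
    [1 / (2 L)] below the last value ([top_value_le]).

    About [Nbar] the construction uses the bound [Nbar <= N] ([Nbar_le]): left
    of its root in [(1, 2)] the function [T_N] is negative, and [T_k] remains
    negative for [k >= N]. *)

(** * Inner product and paraboloids *)

Section Dot.
Context {R : realType} {d : nat}.
Implicit Types x y z : 'rV[R]_d.

Definition dot x y : R := \sum_(i < d) x 0 i * y 0 i.

Lemma dotC x y : dot x y = dot y x.
Proof. by apply: eq_bigr => i _; rewrite mulrC. Qed.

Lemma dotDr x y z : dot x (y + z) = dot x y + dot x z.
Proof. by rewrite -big_split; apply: eq_bigr => i _; rewrite mxE mulrDr. Qed.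

Lemma dotZr a x y : dot x (a *: y) = a * dot x y.
Proof.
by rewrite /dot mulr_sumr; apply: eq_bigr => i _; rewrite mxE mulrCA.
Qed.

Lemma dotDl x y z : dot (x + y) z = dot x z + dot y z.
Proof. by rewrite dotC dotDr !(dotC z). Qed.

Lemma dotZl a x y : dot (a *: x) y = a * dot x y.
Proof. by rewrite dotC dotZr dotC. Qed.

Lemma dotNr x y : dot x (- y) = - dot x y.
Proof. by rewrite -scaleN1r dotZr mulN1r. Qed.

Lemma dotNl x y : dot (- x) y = - dot x y.
Proof. by rewrite dotC dotNr dotC. Qed.

Lemma dot0r x : dot x 0 = 0.
Proof. by rewrite -(scale0r (0 : 'rV_d)) dotZr mul0r. Qed.

Definition dotE := (dotDl, dotDr, dotNl, dotNr, dotZl, dotZr).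

Lemma dot_ge0 x : 0 <= dot x x.
Proof. by apply: sumr_ge0 => i _; rewrite -expr2 sqr_ge0. Qed.

Lemma enorm_sqr x : enorm x ^+ 2 = dot x x.
Proof.
rewrite /enorm sqr_sqrtr; last by apply: sumr_ge0 => i _; exact: sqr_ge0.
by apply: eq_bigr => i _; rewrite expr2.
Qed.

Lemma dot_sumr x (I : Type) (r : seq I) (P : pred I) (F : I -> 'rV[R]_d) :
  dot x (\sum_(i <- r | P i) F i) = \sum_(i <- r | P i) dot x (F i).
Proof. exact: (big_morph (dot x) (dotDr x) (dot0r x)). Qed.

Lemma dot_suml x (I : Type) (r : seq I) (P : pred I) (F : I -> 'rV[R]_d) :
  dot (\sum_(i <- r | P i) F i) x = \sum_(i <- r | P i) dot (F i) x.
Proof. by rewrite dotC dot_sumr; apply: eq_bigr => i _; rewrite dotC. Qed.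

Lemma dot_delta x i : dot x (delta_mx 0 i) = x 0 i.
Proof.
rewrite /dot (bigD1 i)//= mxE !eqxx mulr1 big1 ?addr0// => j ji.
by rewrite mxE (negbTE ji) andbF mulr0.
Qed.

(** Compares the Euclidean norm with the sup norm, in terms of which
    differentiability is defined. *)
Lemma dot_le_norm x : dot x x <= d%:R * `|x| ^+ 2.
Proof.
rewrite mulr_natl -[X in _ *+ X]card_ord -sumr_const.
apply: ler_sum => i _; rewrite -expr2 -(real_normK (num_real _)).
rewrite lerXn2r ?nnegrE//.
rewrite [X in _ <= X]/Num.Def.normr/= mx_normrE.
exact: (le_bigmax _ (fun k : 'I_1 * 'I_d => `|x k.1 k.2|) (0, i)).
Qed.

Definition paraboloid c x g F z : R :=
  F + dot g (z - x) + c / 2 * dot (z - x) (z - x).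

(** The defining inequality of convexity of [W - mu/2 |.|^2], in a form that is
    visibly invariant under translations. *)
Definition mu_convex (mu : R) (W : 'rV[R]_d -> R) :=
  forall a b t, 0 <= t <= 1 ->
  W (t *: a + (1 - t) *: b)
    <= t * W a + (1 - t) * W b - mu / 2 * (t * (1 - t)) * dot (a - b) (a - b).

(** The defect of a paraboloid on a chord depends on the chord only through its
    length; hence a paraboloid of curvature [c] is exactly [c]-convex and
    [c]-concave. *)
Lemma paraboloid_comb c x g F a b t :
  paraboloid c x g F (t *: a + (1 - t) *: b)
  = t * paraboloid c x g F a + (1 - t) * paraboloid c x g F b
    - c / 2 * (t * (1 - t)) * dot (a - b) (a - b).
Proof.
rewrite /paraboloid.
have -> : a - b = (a - x) - (b - x) by rewrite opprB addrA subrK.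
have -> : t *: a + (1 - t) *: b - x = t *: (a - x) + (1 - t) *: (b - x).
  by apply/rowP => i; rewrite !mxE; ring.
move: (a - x) (b - x) => p q; rewrite !dotE (dotC q p); ring.
Qed.

Lemma paraboloid_vertex c x g F z : c != 0 ->
  paraboloid c x g F z = F - dot g g / (2 * c)
  + c / 2 * dot (z - (x - c^-1 *: g)) (z - (x - c^-1 *: g)).
Proof.
move=> c0; rewrite /paraboloid.
have -> : z - (x - c^-1 *: g) = (z - x) + c^-1 *: g.
  by rewrite opprB addrA addrAC.
by move: (z - x) => p; rewrite !dotE (dotC g p); field.
Qed.

Lemma paraboloid_mu_convex mu x g F : mu_convex mu (paraboloid mu x g F).
Proof. by move=> a b t _; rewrite paraboloid_comb. Qed.

Lemma convex_functionP (h : 'rV[R]_d -> R) :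
  (forall a b t, 0 <= t <= 1 ->
     h (t *: a + (1 - t) *: b) <= t * h a + (1 - t) * h b) ->
  convex_function [set: 'rV[R]_d] h.
Proof.
move=> H t a b _ _; have := H a b t%:num.
by rewrite ge0 le1 => /(_ isT).
Qed.

Lemma sqr_comb (a b : 'rV[R]_d) t :
  dot (t *: a + (1 - t) *: b) (t *: a + (1 - t) *: b)
  = t * dot a a + (1 - t) * dot b b - t * (1 - t) * dot (a - b) (a - b).
Proof. by rewrite !dotE (dotC b a); ring. Qed.

(** [mu_convex (- L)] of [- f] is convexity of [L/2 |.|^2 - f]. *)
Lemma Fclass_mu_convex mu L (f : 'rV[R]_d -> R) :
  mu_convex mu f -> mu_convex (- L) (fun x => - f x) -> Fclass mu L f.
Proof.
move=> fmu fL; split; apply: convex_functionP => a b t t01;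
  rewrite !enorm_sqr sqr_comb.
- by have := fL a b t t01; lra.
- by have := fmu a b t t01; lra.
Qed.

(** Two paraboloids touching at [x] squeeze [f] up to second order there. *)
Lemma grad_squeeze mu L x g F (f : 'rV[R]_d -> R) :
  (forall z, paraboloid mu x g F z <= f z) ->
  (forall z, f z <= paraboloid L x g F z) -> grad f x = g.
Proof.
move=> fl fu.
have lin : linear (dot g : 'rV[R]_d -> R^o).
  by move=> a u v; rewrite dotDr dotZr.
pose df : {linear 'rV[R]_d -> R^o} := HB.pack (dot g : 'rV[R]_d -> R^o)
  (GRing.isLinear.Build R 'rV[R]_d R^o *:%R (dot g : 'rV[R]_d -> R^o) lin).
have para0 c : paraboloid c x g F x = F.
  by rewrite /paraboloid subrr !dot0r !(mulr0, addr0).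
have fx : f x = F.
  by apply/eqP; rewrite eq_le -{1}(para0 L) fu -(para0 mu) fl.
have -> : g = \row_i df (delta_mx 0 i).
  by apply/rowP => i; rewrite mxE /= dot_delta.
apply/rowP => i; rewrite !mxE.
suff -> : ('d f x : 'rV[R]_d -> R) = df by [].
apply: diff_unique.
  apply: (@continuous_big R^o _ +%R 0 xpredT add_continuous _ _
    (fun j (h : 'rV[R]_d) => g 0 j * h 0 j)) => j _ y.
  by apply: continuousM; [exact: cst_continuous|exact: coord_continuous].
apply/eqaddoP => _/posnumP[e].
pose C := (`|mu| + `|L|) / 2 * d%:R + 1.
have C0 : 0 < C.
  by rewrite ltr_wpDl// mulr_ge0// divr_ge0// addr_ge0.
near=> h; rewrite /= fx.
have hC : C * `|h| <= e%:num.
  rewrite mulrC -ler_pdivlMr//; near: h.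
  exact: (@nbhs0_le R 'rV[R]_d _ (divr_gt0 (gt0 e) C0)).
have := fl (h + x); have := fu (h + x).
rewrite /paraboloid addrK => hu hl.
have K0 := dot_ge0 h; have Kn := dot_le_norm h.
have -> : (f \o shift x - (cst F + dot g)) h = f (h + x) - (F + dot g h) by [].
have D_le : `|f (h + x) - (F + dot g h)| <= (`|mu| + `|L|) / 2 * dot h h.
  rewrite ler_norml.
  have := ler_norm L; have := ler_norm (- mu); rewrite normrN => m1 L1.
  have [m0 l0] : 0 <= `|mu| /\ 0 <= `|L| by split.
  have p1 : L / 2 * dot h h <= (`|mu| + `|L|) / 2 * dot h h.
    by apply: ler_wpM2r => //; lra.
  have p2 : - mu / 2 * dot h h <= (`|mu| + `|L|) / 2 * dot h h.
    by apply: ler_wpM2r => //; lra.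
  by apply/andP; split; lra.
apply: (@le_trans _ _ (C * `|h| * `|h|)); last exact: ler_wpM2r.
apply: (le_trans D_le).
apply: le_trans (_ : (`|mu| + `|L|) / 2 * (d%:R * `|h| ^+ 2) <= _); last first.
  by rewrite /C expr2; have := normr_ge0 h; nra.
by apply: le_trans (ler_wpM2l _ Kn); rewrite ?divr_ge0 ?addr_ge0.
Unshelve. all: by end_near. Qed.

End Dot.
(** * The largest mu-convex minorant of a family *)

Section Envelope.
Context {R : realType} {d : nat} {I : Type}.
Variables (mu L : R) (U : I -> 'rV[R]_d -> R).

Definition minorant (W : 'rV[R]_d -> R) :=
  mu_convex mu W /\ forall i z, W z <= U i z.

Definition envelope z : R := sup [set W z | W in minorant].

Variables (i0 : I) (W0 : 'rV[R]_d -> R).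
Hypothesis W0P : minorant W0.

Lemma envelope_has_sup z : has_sup [set W z | W in minorant].
Proof.
split; first by exists (W0 z), W0.
by exists (U i0 z) => _ [W [_ WU] <-].
Qed.

Lemma minorant_le W z : minorant W -> W z <= envelope z.
Proof.
by move=> WP; apply: ub_le_sup; [case: (envelope_has_sup z)|exists W].
Qed.

Lemma envelope_le z c : (forall W, minorant W -> W z <= c) -> envelope z <= c.
Proof.
move=> H; apply: ge_sup; first by case: (envelope_has_sup z).
by move=> _ [W WP <-]; exact: H.
Qed.

Lemma envelope_minorant : minorant envelope.
Proof.
split=> [a b t t01|i z]; last by apply: envelope_le => W [].
apply: envelope_le => W WP; have := WP.1 a b t t01.
move/le_trans; apply; case/andP: t01 => t0 t1; rewrite lerD2r lerD//.
- by apply: ler_wpM2l => //; exact: minorant_le.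
- by apply: ler_wpM2l; [rewrite subr_ge0|exact: minorant_le].
Qed.

(** Averaging two translates of a minorant along a chord and lowering the result
    by the worst chord defect of the [U i] gives again a minorant, so maximality
    of the envelope bounds its own chord defect. *)
Lemma envelope_semiconcave :
  (forall i, mu_convex (- L) (fun z => - U i z)) ->
  mu_convex (- L) (fun z => - envelope z).
Proof.
move=> UL a b t t01; have /andP[t0 t1] := t01.
have s0 : 0 <= 1 - t by rewrite subr_ge0.
pose e := a - b.
pose W z := t * envelope (z + (1 - t) *: e)
  + (1 - t) * envelope (z - t *: e) - L / 2 * (t * (1 - t)) * dot e e.
have [ec eU] := envelope_minorant.
have WP : minorant W.
  split=> [p q r r01|i z].
    have /andP[r0 r1] := r01.
    have := ec (p + (1 - t) *: e) (q + (1 - t) *: e) r r01.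
    have := ec (p - t *: e) (q - t *: e) r r01.
    rewrite /W.
    have -> (y : 'rV[R]_d) : r *: (p + y) + (1 - r) *: (q + y)
        = r *: p + (1 - r) *: q + y.
      by apply/rowP => k; rewrite !mxE; ring.
    have -> (y : 'rV[R]_d) : r *: (p + y) + (1 - r) *: (q + y)
        = r *: p + (1 - r) *: q + y.
      by apply/rowP => k; rewrite !mxE; ring.
    have -> (y : 'rV[R]_d) : p + y - (q + y) = p - q.
      by apply/rowP => k; rewrite !mxE; ring.
    have -> (y : 'rV[R]_d) : p + y - (q + y) = p - q.
      by apply/rowP => k; rewrite !mxE; ring.
    move=> /(ler_wpM2l s0) h1 /(ler_wpM2l t0) h2; lra.
  have := UL i (z + (1 - t) *: e) (z - t *: e) t t01.
  have -> : t *: (z + (1 - t) *: e) + (1 - t) *: (z - t *: e) = z.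
    by apply/rowP => k; rewrite !mxE; ring.
  have -> : z + (1 - t) *: e - (z - t *: e) = e.
    by apply/rowP => k; rewrite !mxE; ring.
  have := ler_wpM2l t0 (eU i (z + (1 - t) *: e)).
  have := ler_wpM2l s0 (eU i (z - t *: e)).
  rewrite /W; lra.
have := minorant_le (t *: a + (1 - t) *: b) WP.
rewrite /W.
have -> : t *: a + (1 - t) *: b + (1 - t) *: e = a.
  by apply/rowP => k; rewrite !mxE; ring.
have -> : t *: a + (1 - t) *: b - t *: e = b.
  by apply/rowP => k; rewrite !mxE; ring.
rewrite -/e; lra.
Qed.

End Envelope.

(** The envelope of the upper paraboloids lies above the lower ones, which are
    [mu]-convex minorants, so at each [x i] it is squeezed between two
    paraboloids with the prescribed value and gradient. *)
Lemma interpolation (R : realType) (d : nat) (I : Type) (i0 : I) (mu L : R)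
    (x g : I -> 'rV[R]_d) (F : I -> R) :
  (forall i j z,
     paraboloid mu (x j) (g j) (F j) z <= paraboloid L (x i) (g i) (F i) z) ->
  exists f, [/\ Fclass mu L f, forall i, f (x i) = F i,
    forall i, grad f (x i) = g i,
    forall i z, f z <= paraboloid L (x i) (g i) (F i) z &
    forall W, mu_convex mu W ->
      (forall i z, W z <= paraboloid L (x i) (g i) (F i) z) ->
      forall z, W z <= f z].
Proof.
move=> H; pose U i := paraboloid L (x i) (g i) (F i).
pose V j := paraboloid mu (x j) (g j) (F j).
have VP j : minorant mu U (V j).
  by split=> [|i]; [exact: paraboloid_mu_convex|exact: H].
have [fc fU] := envelope_minorant i0 (VP i0).
have fV j z : V j z <= envelope mu U z := minorant_le i0 (VP i0) z (VP j).
have at_x c i : paraboloid c (x i) (g i) (F i) (x i) = F i.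
  by rewrite /paraboloid subrr !dot0r !(mulr0, addr0).
exists (envelope mu U); split=> //.
- apply: Fclass_mu_convex => //; apply: (envelope_semiconcave i0 (VP i0)) => i.
  by move=> a b t _; rewrite /U paraboloid_comb; lra.
- by move=> i; apply/eqP; rewrite eq_le -{1}(at_x L i) fU -(at_x mu i) fV.
- by move=> i; exact: (grad_squeeze (fV i) (fU i)).
- by move=> W Wc WU z; exact: (minorant_le i0 (VP i0) z (conj Wc WU)).
Qed.
(** * Interpolability of a chain of gradient steps *)

Section Chain.
Context {R : realType} {d : nat}.
Variables (L m gam : R) (N : nat).
Hypotheses (L0 : 0 < L) (m0 : 0 < m) (gam0 : 0 < gam).
Variables (u v x : nat -> 'rV[R]_d) (F : nat -> R).

Let rho := 1 - gam * L.
Let eta := 1 + gam * m.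
Let g k := u k + v k.

Hypothesis gS : forall k, g k.+1 = rho *: u k + eta *: v k.
Hypothesis xS : forall k, x k.+1 = x k - gam *: g k.
Hypothesis FS : forall k,
  F k.+1 = F k - gam / 2 * (dot (g k) (g k) + dot (g k) (g k.+1)).
Hypothesis uv0 : forall k l, (k <= l < N)%N -> dot (u k) (v l) = 0.
Hypothesis uv_ge0 : forall l j, (l < j <= N)%N ->
  0 <= \sum_(l <= k < j) dot (u k) (v l).

(* The centres of the upper and of the lower paraboloid at step [k]. *)
Let top k := x k - L^-1 *: g k.
Let bot k := x k + m^-1 *: g k.

Lemma topS k : top k.+1 = top k - (gam * (L + m) / L) *: v k.
Proof.
rewrite /top xS gS /g /rho /eta.
by apply/rowP => i; rewrite !mxE; field; rewrite gt_eqF.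
Qed.

Lemma botS k : bot k.+1 = bot k - (gam * (L + m) / m) *: u k.
Proof.
rewrite /bot xS gS /g /rho /eta.
by apply/rowP => i; rewrite !mxE; field; rewrite gt_eqF.
Qed.

Lemma bot_sum i j : (i <= j)%N ->
  bot j = bot i - (gam * (L + m) / m) *: \sum_(i <= k < j) u k.
Proof.
elim: j => [|j IH].
  by rewrite leqn0 => /eqP ->; rewrite big_geq// scaler0 subr0.
rewrite leq_eqVlt => /orP[/eqP ->|]; first by rewrite big_geq// scaler0 subr0.
rewrite ltnS => ij; rewrite big_nat_recr//= botS IH//.
by apply/rowP => a; rewrite !mxE; ring.
Qed.

(** The minimum over [z] of the upper paraboloid at [i] minus the lower one at
    [j]. *)
Let gap i j := (F i - dot (g i) (g i) / (2 * L))
  - (F j + dot (g j) (g j) / (2 * m))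
  + L * m / (2 * (L + m)) * dot (bot j - top i) (bot j - top i).

(** For two curvatures [L] and [m] and centres [a] and [b], the sum
    [L/2 |z - a|^2 + m/2 |z - b|^2] is least at the weighted mean of the
    centres. *)
Lemma paraboloid_le_gap i j z : 0 <= gap i j ->
  paraboloid (- m) (x j) (g j) (F j) z <= paraboloid L (x i) (g i) (F i) z.
Proof.
rewrite !paraboloid_vertex ?oppr_eq0 ?gt_eqF// invrN scaleNr opprK.
rewrite -/(bot j) -/(top i).
rewrite /gap.
have -> : bot j - top i = (z - top i) - (z - bot j).
  by apply/rowP => a; rewrite !mxE; ring.
move: (z - top i) (z - bot j) => p q gap_ge0.
have Lm0 : 0 < L + m by exact: addr_gt0.
(* The deviation of [z] from the weighted mean of the two centres. *)
have : 0 <= dot (L *: p + m *: q) (L *: p + m *: q) / (2 * (L + m)).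
  by rewrite divr_ge0 ?dot_ge0// mulr_ge0// ltW.
have -> : dot (L *: p + m *: q) (L *: p + m *: q) / (2 * (L + m))
    = L / 2 * dot p p + m / 2 * dot q q
      - L * m / (2 * (L + m)) * dot (p - q) (p - q).
  by rewrite !dotE (dotC q p); field; rewrite gt_eqF.
rewrite -subr_ge0 => invsqr_ge0.
rewrite -subr_ge0; apply: le_trans (addr_ge0 gap_ge0 invsqr_ge0) _.
rewrite le_eqVlt; apply/orP; left; apply/eqP.
by field; rewrite !gt_eqF.
Qed.

Lemma gap_diag j : gap j j = 0.
Proof.
rewrite /gap.
have -> : bot j - top j = ((L + m) / (L * m)) *: g j.
  by apply/rowP => a; rewrite /bot /top !mxE; field; rewrite !gt_eqF.
by rewrite !dotE; field; rewrite !gt_eqF ?addr_gt0.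
Qed.

Lemma gapS i j : (i < N)%N ->
  gap i.+1 j = gap i j + gam * (m * dot (bot j - top i) (v i)
                               - (L + m) / L * dot (v i) (v i)).
Proof.
move=> iN; have uvi : dot (u i) (v i) = 0 by rewrite uv0// leqnn.
rewrite /gap FS topS.
have -> : bot j - (top i - (gam * (L + m) / L) *: v i)
    = (bot j - top i) + (gam * (L + m) / L) *: v i.
  by rewrite opprB addrA addrAC.
move: (bot j - top i) => D.
rewrite !gS /g /rho /eta !dotE (dotC (v i) (u i)) uvi (dotC (v i) D).
by field; rewrite !gt_eqF ?addr_gt0.
Qed.

(** Moving [top i] by a multiple of [v i] changes the gap through the inner
    product of [v i] with [bot j - top i], which differs from a multiple of
    [g i] by the [u k] between [i] and [j].  The multiple of [g i] cancels the
    quadratic term; for [j <= i] the remaining [u k] are orthogonal to [v i]. *)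
Lemma gap_stepE i j : (i < N)%N ->
  gap i.+1 j = gap i j + (if (i < j)%N
    then - (gam ^+ 2 * (L + m) * \sum_(i <= k < j) dot (u k) (v i)) else 0).
Proof.
move=> iN; rewrite gapS//; congr (_ + _).
have uvi : dot (u i) (v i) = 0 by rewrite uv0// leqnn.
have bt : bot i - top i = ((L + m) / (L * m)) *: g i.
  by apply/rowP => a; rewrite /bot /top !mxE; field; rewrite !gt_eqF.
case: ltnP => [/ltnW ij|ji].
- rewrite (bot_sum ij) addrAC bt /g !dotE uvi dot_suml.
  by field; rewrite !gt_eqF.
- have -> : bot j = bot i + (gam * (L + m) / m) *: \sum_(j <= k < i) u k.
    by rewrite (bot_sum ji) subrK.
  rewrite addrAC bt /g !dotE uvi dot_suml big_nat big1 => [|k /andP[_ ki]].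
    by field; rewrite !gt_eqF.
  by rewrite uv0// iN ltnW.
Qed.

(** Starting from the diagonal, the gap stays 0 as [i] grows, and is a sum of
    nonnegative terms as [i] decreases. *)
Lemma gap_ge0 i j : (i <= N)%N -> (j <= N)%N -> 0 <= gap i j.
Proof.
move=> iN jN; case: (leqP j i) => [ji|/ltnW ij].
  suff -> : gap i j = 0 by [].
  move: iN; elim: i ji => [|i IH].
    by rewrite leqn0 => /eqP -> _; exact: gap_diag.
  rewrite leq_eqVlt => /orP[/eqP -> _|]; first exact: gap_diag.
  by rewrite ltnS => ji iN; rewrite gap_stepE// ltnNge ji addr0 IH// ltnW.
have -> : i = (j - (j - i))%N by rewrite subKn.
elim: (j - i)%N (leq_subr i j) => [|n IH] nj; first by rewrite subn0 gap_diag.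
apply: le_trans (IH (ltnW nj)) _.
have e : (j - n)%N = (j - n.+1).+1 by rewrite subnSK.
have lt1 : (j - n.+1 < j)%N by rewrite ltn_subrL (leq_ltn_trans _ nj).
rewrite e (gap_stepE _ (leq_trans lt1 jN)) lt1 gerDl oppr_le0.
by rewrite mulr_ge0 ?uv_ge0 ?lt1// mulr_ge0 ?sqr_ge0// addr_ge0 ?ltW.
Qed.

Lemma chain_interpolable i j z : (i <= N)%N -> (j <= N)%N ->
  paraboloid (- m) (x j) (g j) (F j) z <= paraboloid L (x i) (g i) (F i) z.
Proof. by move=> iN jN; apply: paraboloid_le_gap; exact: gap_ge0. Qed.

(** As [u k] and [v k] are orthogonal, the [k]-th step lowers the vertex value by
    a positive multiple of [dot (v k) (v k)]. *)
Lemma top_value_le i : (i <= N)%N ->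
  F N - dot (g N) (g N) / (2 * L) <= F i - dot (g i) (g i) / (2 * L).
Proof.
move=> iN; have -> : i = (N - (N - i))%N by rewrite subKn.
elim: (N - i)%N (leq_subr i N) => [|n IH] nN; first by rewrite subn0.
apply: le_trans (IH (ltnW nN)) _.
have -> : (N - n)%N = (N - n.+1).+1 by rewrite subnSK.
have : (N - n.+1 < N)%N by rewrite ltn_subrL (leq_ltn_trans _ nN).
move: (N - n.+1)%N => k kN.
have uvk : dot (u k) (v k) = 0 by rewrite uv0// leqnn.
rewrite FS !gS /g !dotE (dotC (v k) (u k)) uvk /rho /eta -subr_ge0.
set X := (X in 0 <= X).
have -> : X = gam / 2 * (2 + gam * m) * ((L + m) / L) * dot (v k) (v k).
  by rewrite /X; field; rewrite gt_eqF.
have Lm0 : 0 < (L + m) / L by rewrite divr_gt0// addr_gt0.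
have gm0 : 0 < 2 + gam * m by rewrite addr_gt0// mulr_gt0.
by rewrite mulr_ge0 ?dot_ge0// ltW// mulr_gt0// mulr_gt0// divr_gt0.
Qed.

End Chain.
(** * Frames that keep the gradient norm at 1 *)

(** The recursion [theta k.+1 >= rho * theta k] with [-1 <= rho <= 0] allows the
    terms to alternate in sign, but keeps the partial sums nonnegative. *)
Lemma partial_sum_ge0 (R : realType) (rho : R) (theta : nat -> R) (l j : nat) :
  -1 <= rho <= 0 -> 0 <= theta l ->
  (forall k, (l <= k < j)%N -> rho * theta k <= theta k.+1) ->
  0 <= \sum_(l <= k < j) theta k.
Proof.
move=> /andP[r1 r0] th0 thS; case: (leqP l j) => [lj|/ltnW jl];
  last by rewrite big_geq.
(* Invariant: the next term is at least [rho] times the sum before it, so adding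
   it leaves at least the fraction [1 + rho] of the sum. *)
suff : 0 <= \sum_(l <= k < j) theta k
    /\ rho * \sum_(l <= k < j) theta k <= theta j by case.
elim: j lj thS => [|j IH].
  by rewrite leqn0 => /eqP l0 _; rewrite big_geq// mulr0; rewrite l0 in th0.
rewrite leq_eqVlt => /orP[/eqP <- _|]; first by rewrite big_geq ?mulr0.
rewrite ltnS => lj thS; rewrite big_nat_recr//=.
have [|S0 rS] := IH lj; first by move=> k /andP[lk kj]; rewrite thS// lk ltnW.
have := thS j; rewrite lj ltnSn => /(_ isT) thj.
by split; nra.
Qed.

Section Frames.
Context {R : realType}.
Variables (rho eta : R) (N Nb : nat).
Hypotheses (rhoN1 : -1 < rho) (rho0 : rho < 0) (eta1 : 1 < eta).

(** The squared lengths of [u] and [v] for which both [u + v] and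
    [rho u + eta v] have norm 1. *)
Definition umass : R := (eta ^+ 2 - 1) / (eta ^+ 2 - rho ^+ 2).
Definition vmass : R := (1 - rho ^+ 2) / (eta ^+ 2 - rho ^+ 2).

Definition basis (k : nat) : 'rV[R]_(N.+2) := \row_j (j == k :> nat)%:R.

(** The pair [(u k, v k)].  Coordinates 0 and 1 carry the quadratic phase; step
    [k >= Nb] brings in coordinate [k + 2], which none of the earlier vectors
    uses.  The first component is forced by [u + v] having to be the gradient
    [rho u + eta v] of the quadratic after the step. *)
Fixpoint frame (k : nat) : 'rV[R]_(N.+2) * 'rV[R]_(N.+2) :=
  if k is k'.+1 then
    let: (u, v) := frame k' in
    let v' := if (k' < Nb)%N then eta *: v
              else eta^-1 *: v
                   + Num.sqrt (vmass * (1 - eta ^- 2)) *: basis k'.+2 in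
    (rho *: u + eta *: v - v', v')
  else ((rho ^- Nb * Num.sqrt umass) *: basis 0,
        (eta ^- Nb * Num.sqrt vmass) *: basis 1).

Let u k := (frame k).1.
Let v k := (frame k).2.

Let eta0 : 0 < eta. Proof. exact: lt_trans eta1. Qed.
Let rho2 : 0 < 1 - rho ^+ 2.
Proof.
have -> : 1 - rho ^+ 2 = (1 - rho) * (1 + rho) by ring.
by rewrite mulr_gt0//; move: rhoN1 rho0; lra.
Qed.
Let eta2 : 0 < eta ^+ 2 - 1.
Proof. by rewrite subr_gt0 exprn_egt1. Qed.
Let eta_rho2 : 0 < eta ^+ 2 - rho ^+ 2.
Proof. by have := rho2; have := eta2; lra. Qed.
Let eta_neq0 : eta != 0. Proof. by rewrite gt_eqF. Qed.
Let rho_neq0 : rho != 0. Proof. by rewrite lt_eqF. Qed.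
Let er_neq0 : eta ^+ 2 - rho ^+ 2 != 0. Proof. by rewrite gt_eqF. Qed.

Let re_neq0 : rho + eta != 0.
Proof. by rewrite gt_eqF//; move: rhoN1 eta1; lra. Qed.
Let rhoV_ge1 : 1 <= rho ^- 2.
Proof.
have h : 0 < rho ^+ 2 by rewrite exprn_even_gt0.
by rewrite invf_ge1// ltW// -subr_gt0.
Qed.
Let etaV_ge0 : 0 <= eta ^- 2. Proof. by rewrite invr_ge0 sqr_ge0. Qed.
Let etaV_le1 : eta ^- 2 <= 1.
Proof. by rewrite invf_le1 ?exprn_gt0// ltW// -subr_gt0. Qed.

Lemma umass_gt0 : 0 < umass. Proof. exact: divr_gt0. Qed.
Lemma vmass_gt0 : 0 < vmass. Proof. exact: divr_gt0. Qed.

Lemma mass1 : umass + vmass = 1.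
Proof. by rewrite /umass /vmass; field. Qed.

Lemma dot_basis a b : (a < N.+2)%N -> dot (basis a) (basis b) = (a == b)%:R.
Proof.
move=> aN; rewrite /dot (bigD1 (Ordinal aN))//= !mxE/= eqxx mul1r.
rewrite big1 ?addr0 ?(inj_eq val_inj)// => j ja.
by rewrite !mxE (negbTE (ja : (j : nat) != a)) mul0r.
Qed.

Lemma dot_basis_neq a b : a != b -> dot (basis a) (basis b) = 0.
Proof.
move=> ab; rewrite /dot big1// => j _; rewrite !mxE.
by case: eqP => [->|]; rewrite ?(negbTE ab) ?mulr0 ?mul0r.
Qed.

Lemma frameS k : u k.+1 + v k.+1 = rho *: u k + eta *: v k.
Proof. by rewrite /u /v /=; case: (frame k) => a b /=; rewrite subrK. Qed.

Lemma frame_quad k : (k < Nb)%N -> u k.+1 = rho *: u k /\ v k.+1 = eta *: v k.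
Proof. by rewrite /u /v /= => ->; case: (frame k) => a b /=; rewrite addrK. Qed.

Lemma frame_turn k : (Nb <= k)%N ->
  v k.+1 = eta^-1 *: v k + Num.sqrt (vmass * (1 - eta ^- 2)) *: basis k.+2.
Proof. by rewrite /u /v /= leqNgt => /negbTE ->; case: (frame k). Qed.

Lemma frame_uS k : u k.+1 = rho *: u k + eta *: v k - v k.+1.
Proof. by rewrite -frameS addrK. Qed.

Lemma frame_fresh k l : (k <= l)%N ->
  dot (u k) (basis l.+2) = 0 /\ dot (v k) (basis l.+2) = 0.
Proof.
elim: k => [|k IH] kl.
  by rewrite /u /v /= !dotZl !dot_basis_neq ?mulr0.
have [ul vl] := IH (ltnW kl); rewrite frame_uS.
suff vl' : dot (v k.+1) (basis l.+2) = 0.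
  by rewrite !dotE ul vl vl' !mulr0 !(addr0,subr0).
case: (ltnP k Nb) => [/frame_quad[_ ->]|/frame_turn ->].
  by rewrite dotZl vl mulr0.
by rewrite !dotE vl dot_basis_neq ?mulr0 ?addr0// !eqSS neq_ltn kl.
Qed.

(** In the truncated exponent [Nb - k] both phases are covered: it counts the
    remaining steps of the quadratic phase and is 0 afterwards.
    From index [Nb] on, the new direction makes up exactly for the part of the
    [v]-component that is lost in the contraction by [eta^-1]. *)
Lemma frame_dots k : (k <= N)%N ->
  [/\ dot (u k) (v k) = 0,
      dot (u k) (u k) = umass * (rho ^- 2) ^+ (Nb - k) &
      dot (v k) (v k) = vmass * (eta ^- 2) ^+ (Nb - k)].
Proof.
elim: k => [|k IH] kN.
  rewrite /u /v /= !dotE !dot_basis// subn0 /= !mulr0 !mulr1.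
  have sq (a : R) b n : 0 <= b ->
      a ^- n * Num.sqrt b * (a ^- n * Num.sqrt b) = b * (a ^- 2) ^+ n.
    move=> b0; rewrite mulrACA -expr2 -expr2 sqr_sqrtr// mulrC.
    by rewrite !exprVn -!exprM mulnC.
  by rewrite !sq// ltW ?umass_gt0 ?vmass_gt0.
have [uv uu vv] := IH (ltnW kN).
case: (ltnP k Nb) => kNb.
  have [-> ->] := frame_quad kNb.
  rewrite !dotE uv uu vv -(subnSK kNb) !exprS !mulr0; split=> //.
    by field.
  by field.
rewrite frame_uS frame_turn//.
have [fu fv] := frame_fresh (leqnn k).
have /eqP n0 : (Nb - k == 0)%N by rewrite subn_eq0.
have /eqP n1 : (Nb - k.+1 == 0)%N by rewrite subn_eq0 ltnW.
rewrite n0 !expr0 !mulr1 in uu vv; rewrite n1 !expr0 !mulr1.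
set s := Num.sqrt _.
have s2 : s * s = vmass * (1 - eta ^- 2).
  by rewrite -expr2 sqr_sqrtr// mulr_ge0 ?(ltW vmass_gt0)// subr_ge0.
have ee : dot (basis k.+2) (basis k.+2) = 1 by rewrite dot_basis ?eqxx.
rewrite !dotE (dotC (basis _) (v k)) (dotC (basis _) (u k)) (dotC (v k) (u k)).
rewrite fu fv uv uu vv ee !(mulr0, mulr1, mul0r, add0r, addr0).
split.
- by rewrite s2; field.
- by rewrite s2 /umass /vmass; field; rewrite er_neq0.
- by rewrite s2; field.
Qed.

(** Each later [v l] is a multiple of the previous one plus a fresh direction,
    so orthogonality to [u k] persists. *)
Lemma frame_orth k l : (k <= l <= N)%N -> dot (u k) (v l) = 0.
Proof.
case/andP => + lN; elim: l lN => [|l IH] lN.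
  by rewrite leqn0 => /eqP ->; case: (frame_dots (leq0n N)).
rewrite leq_eqVlt => /orP[/eqP ->|]; first by case: (frame_dots lN).
rewrite ltnS => kl; have uv := IH (ltnW lN) kl.
case: (ltnP l Nb) => [/frame_quad[_ ->]|/frame_turn ->].
  by rewrite dotZr uv mulr0.
by rewrite !dotE uv (frame_fresh kl).1 !mulr0 addr0.
Qed.

Lemma frame_vv_ge0 k l : (l <= k)%N -> 0 <= dot (v k) (v l).
Proof.
elim: k => [|k IH]; first by rewrite leqn0 => /eqP ->; exact: dot_ge0.
rewrite leq_eqVlt => /orP[/eqP ->|]; first exact: dot_ge0.
rewrite ltnS => lk; have vv := IH lk.
case: (ltnP k Nb) => [/frame_quad[_ ->]|/frame_turn ->].
  by rewrite dotZl mulr_ge0// ltW.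
rewrite !dotE [X in _ + _ * X]dotC (frame_fresh lk).2 mulr0 addr0.
by rewrite mulr_ge0// invr_ge0 ltW.
Qed.

(** The vector [u k.+1 - rho u k = eta v k - v k.+1] has a nonnegative inner
    product with [v l], which gives the recursion of [partial_sum_ge0]. *)
Lemma frame_uv_sum_ge0 l j : (l < j <= N)%N ->
  0 <= \sum_(l <= k < j) dot (u k) (v l).
Proof.
case/andP => lj jN; apply: (@partial_sum_ge0 _ rho).
- by rewrite !ltW.
- by rewrite frame_orth// leqnn ltnW// (leq_trans lj).
move=> k /andP[lk kj]; rewrite frame_uS -subr_ge0 !dotE.
rewrite -addrA -addrA [X in 0 <= X]addrC addrA addrNK.
case: (ltnP k Nb) => [/frame_quad[_ ->]|/frame_turn ->].
  by rewrite dotZl subrr.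
rewrite !dotE [X in _ + _ * X]dotC (frame_fresh lk).2 mulr0 addr0 -mulrBl.
rewrite mulr_ge0 ?frame_vv_ge0// subr_ge0.
by rewrite (le_trans _ (ltW eta1))// invf_le1// ltW.
Qed.

Let g k := u k + v k.

Lemma frame_norm k : (k <= N)%N -> dot (g k) (g k)
  = umass * (rho ^- 2) ^+ (Nb - k) + vmass * (eta ^- 2) ^+ (Nb - k).
Proof.
move=> kN; have [uv uu vv] := frame_dots kN.
by rewrite /g !dotE (dotC (v k)) uv uu vv add0r addr0.
Qed.

(** Going backwards from step [Nb] multiplies the mass of [u] by
    [rho^-2 >= 1] and that of [v] by [eta^-2 <= 1].  The first of these steps
    backwards does not decrease the norm, as [rho^2 <= eta^2]; the further ones
    favour the growing part even more. *)
Lemma frame_norm_ge1 k : (k <= N)%N -> 1 <= dot (g k) (g k).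
Proof.
move=> kN; rewrite frame_norm//; elim: (Nb - k)%N => [|n IH].
  by rewrite !expr0 !mulr1 mass1.
apply: le_trans IH _; rewrite -subr_ge0 ![_ ^+ n.+1]exprSr.
set X := _ ^+ n; set Y := _ ^+ n.
have X1 : 1 <= X.
  exact: exprn_ege1.
have Y0 : 0 <= Y by exact: exprn_ge0.
have Y1 : Y <= 1 by exact: exprn_ile1.
have -> : umass * (X * rho ^- 2) + vmass * (Y * eta ^- 2)
     - (umass * X + vmass * Y)
   = (eta ^+ 2 - 1) * (1 - rho ^+ 2) / (eta ^+ 2 - rho ^+ 2)
     * (X / rho ^+ 2 - Y / eta ^+ 2).
  by rewrite /umass /vmass; field; rewrite rho_neq0 eta_neq0.
rewrite mulr_ge0//; first by rewrite ltW// divr_gt0// mulr_gt0.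
rewrite subr_ge0; apply: (@le_trans _ _ 1).
  exact: mulr_ile1.
exact: mulr_ege1.
Qed.

Lemma frame_norm1 k : (Nb <= k <= N)%N -> dot (g k) (g k) = 1.
Proof.
case/andP => /eqP kNb kN; rewrite frame_norm//.
by rewrite kNb !expr0 !mulr1 mass1.
Qed.

Lemma frame_decrease k : (k < N)%N ->
  dot (g k) (g k) + dot (g k) (g k.+1)
  = umass * ((1 + rho) * (rho ^- 2) ^+ (Nb - k))
    + vmass * ((1 + eta) * (eta ^- 2) ^+ (Nb - k)).
Proof.
move=> kN; have [uv uu vv] := frame_dots (ltnW kN).
rewrite /g frameS !dotE (dotC (v k)) uv uu vv; ring.
Qed.

(** Pairs the exponents [2k - 1] and [2k]. *)
Lemma Efun_geom n (x : R) : x != 0 ->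
  Efun n x = (1 + x) * \sum_(1 <= k < n.+1) (x ^- 2) ^+ k.
Proof.
move=> x0; rewrite /Efun; elim: n => [|n IH]; first by rewrite !big_geq ?mulr0.
rewrite doubleS (big_nat_recr n.*2.+2)//= (big_nat_recr n.*2.+1)//= IH.
rewrite (big_nat_recr n.+1)//= mulrDr -addrA; congr (_ + _).
rewrite -[in RHS]exprVn -exprM mul2n doubleS -!exprVn [_ ^+ n.*2.+2]exprS.
by move: (_ ^+ n.*2.+1) => y; field.
Qed.

(** The quadratic phase contributes the geometric sums, the turning phase a
    constant per step. *)
Lemma frame_total : (Nb <= N)%N ->
  \sum_(0 <= k < N) (dot (g k) (g k) + dot (g k) (g k.+1))
  = umass * Efun Nb rho + vmass * Efun Nb eta
    + (1 + rho) * (1 + eta) / (rho + eta) * (N%:R - Nb%:R).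
Proof.
move=> NbN; rewrite (@big_cat_nat _ _ _ Nb)//=; congr (_ + _).
  have geom (y : R) : \sum_(0 <= k < Nb) y ^+ (Nb - k)
      = \sum_(1 <= k < Nb.+1) y ^+ k.
    rewrite [RHS]big_add1 /= [RHS]big_nat_rev /= add0n.
    by apply: eq_big_nat => k /andP[_ kNb]; rewrite subnSK.
  rewrite !Efun_geom// -!geom !mulr_sumr -big_split/=.
  apply: eq_big_nat => k /andP[_ kNb].
  by rewrite frame_decrease// (leq_trans kNb).
rewrite (@eq_big_nat _ _ _ _ _ _ (fun=> umass * (1 + rho) + vmass * (1 + eta))).
  rewrite sumr_const_nat -[LHS]mulr_natr natrB//; congr (_ * _).
  by rewrite /umass /vmass; field; rewrite er_neq0 re_neq0.
move=> k /andP[/eqP kNb kN].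
by rewrite frame_decrease// kNb !expr0 !mulr1.
Qed.

Lemma frame_decrease_gt0 k : (k < N)%N ->
  0 < dot (g k) (g k) + dot (g k) (g k.+1).
Proof.
move=> kN; rewrite frame_decrease//.
have r1 : 0 < 1 + rho by rewrite -(opprK 1) addrC subr_gt0.
have e1 : 0 < 1 + eta by rewrite addr_gt0.
apply: ltr_pwDl.
  rewrite mulr_gt0 ?umass_gt0// mulr_gt0// (lt_le_trans ltr01)//.
  exact: exprn_ege1.
by rewrite mulr_ge0 ?(ltW vmass_gt0)// mulr_ge0 ?(ltW e1)// exprn_ge0.
Qed.

End Frames.
(** * The length of the quadratic phase *)

Section Threshold.
Context {R : realType}.
Implicit Types (n k : nat) (l kappa x X Y r : R).

Definition geom n x : R := \sum_(1 <= k < n.+1) x ^+ k.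

Lemma invsqr_ge0 x : 0 <= x ^- 2.
Proof. by rewrite invr_ge0 sqr_ge0. Qed.

Lemma geom_ge0 n x : 0 <= x -> 0 <= geom n x.
Proof. by move=> x0; apply: sumr_ge0 => k _; exact: exprn_ge0. Qed.

Lemma geom_gt0 n x : (0 < n)%N -> 0 < x -> 0 < geom n x.
Proof.
case: n => // n _ x0; rewrite /geom big_nat_recl// ltr_pwDl ?exprn_gt0//.
by apply: sumr_ge0 => k _; rewrite exprn_ge0 ?ltW.
Qed.

Lemma geom_le n X Y : 0 <= X <= Y -> geom n X <= geom n Y.
Proof.
move=> /andP[X0 XY]; apply: ler_sum => k _.
by rewrite lerXn2r ?nnegrE// (le_trans X0).
Qed.

(** Scaling the argument by [r >= 1] multiplies [geom n] by an average of the
    powers of [r] which weighs the high powers more, the larger the argument. *)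
Lemma geom_scale n X Y r : 0 <= Y <= X -> 1 <= r ->
  geom n X * geom n (r * Y) <= geom n (r * X) * geom n Y.
Proof.
move=> /andP[Y0 YX] r1; have X0 := le_trans Y0 YX.
have r0 : 0 <= r := le_trans ler01 r1.
pose c i j := (r ^+ i - r ^+ j) * (X ^+ i * Y ^+ j).
rewrite -subr_ge0 /geom !big_distrlr/= -sumrB.
rewrite (eq_bigr (fun i => \sum_(1 <= j < n.+1) c i j)) => [|i _]; last first.
  rewrite -sumrB; apply: eq_bigr => j _.
  by rewrite /c !exprMn; ring.
set A := \sum_(_ <= _ < _) _.
suff : 0 <= A + A by rewrite -mulr2n pmulrn_lge0.
rewrite {2}/A exchange_big_nat /= -big_split /=; apply: sumr_ge0 => i _.
rewrite -big_split /=; apply: sumr_ge0 => j _.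
have -> : c i j + c j i
    = (r ^+ i - r ^+ j) * (X ^+ i * Y ^+ j - X ^+ j * Y ^+ i).
  by rewrite /c; ring.
have mono a b : (a <= b)%N -> 0 <= r ^+ b - r ^+ a
    /\ 0 <= X ^+ b * Y ^+ a - X ^+ a * Y ^+ b.
  move=> ab; split; first by rewrite subr_ge0 ler_weXn2l.
  rewrite -(subnK ab); move: (b - a)%N => p.
  have -> : X ^+ (p + a) * Y ^+ a - X ^+ a * Y ^+ (p + a)
      = X ^+ a * Y ^+ a * (X ^+ p - Y ^+ p) by rewrite !exprD; ring.
  by rewrite mulr_ge0 ?mulr_ge0 ?exprn_ge0// subr_ge0 lerXn2r ?nnegrE.
case: (leqP i j) => [|/ltnW] /mono[h1 h2]; last exact: mulr_ge0.
by rewrite -mulrNN !opprB mulr_ge0.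
Qed.

Lemma Tfun_geom n l kappa : 1 - kappa * l != 0 -> 1 - l != 0 ->
  Tfun n l kappa = (2 - kappa * l) * geom n ((1 - kappa * l) ^- 2)
                   - (2 - l) * geom n ((1 - l) ^- 2).
Proof.
move=> e0 r0; rewrite /Tfun !Efun_geom// /geom.
by congr (_ * _ - _ * _); ring.
Qed.

(** Both terms of [Tfun_geom] are compared at [l1 < l2].  The factor
    [2 - kappa l] grows and [2 - l] decreases.  For the geometric sums, the
    argument of the first is scaled by [r = ((1 - kappa l2) / (1 - kappa l1))^2]
    from [l2] to [l1] and that of the second by an even larger factor, while
    being larger itself; so [geom_scale] applies. *)
Lemma Tfun_gt0 n l1 l2 kappa :
  kappa < 0 -> (0 < n)%N -> 1 < l1 < l2 -> l2 < 2 ->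
  0 <= Tfun n l1 kappa -> 0 < Tfun n l2 kappa.
Proof.
move=> kap0 n0 /andP[l1_gt1 l12] l2_lt2.
have l2_gt1 := lt_trans l1_gt1 l12.
have e1 : 1 < 1 - kappa * l1 by nra.
have e12 : 1 - kappa * l1 < 1 - kappa * l2 by nra.
have [r1 r2] : 1 - l1 < 0 /\ 1 - l2 < 0 by split; lra.
have [e1p e2p] : 0 < 1 - kappa * l1 /\ 0 < 1 - kappa * l2 by split; lra.
rewrite !Tfun_geom; try by [rewrite gt_eqF|rewrite lt_eqF].
have key : geom n ((1 - l2) ^- 2) * geom n ((1 - kappa * l1) ^- 2)
  <= geom n ((1 - l1) ^- 2) * geom n ((1 - kappa * l2) ^- 2).
  set e := 1 - kappa * l1; set f := 1 - kappa * l2.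
  set p := 1 - l1; set q := 1 - l2.
  have [p0 q0] : p != 0 /\ q != 0 by rewrite !lt_eqF.
  have [e0 f0] : e != 0 /\ f != 0 by rewrite !gt_eqF.
  have -> : e ^- 2 = (f / e) ^+ 2 * f ^- 2 by field; rewrite e0 f0.
  apply: le_trans (geom_scale n _ _) _.
  - rewrite invsqr_ge0 /=; apply: (@le_trans _ _ 1).
      by rewrite invf_le1 ?exprn_gt0// exprn_ege1// /f; lra.
    rewrite invf_ge1 ?exprn_even_gt0// -sqrrN exprn_ile1//; rewrite /q; lra.
  - by rewrite exprn_ege1// ler_pdivlMr// mul1r ltW.
  apply: ler_wpM2r; first exact/geom_ge0/invsqr_ge0.
  apply: geom_le; rewrite mulr_ge0 ?sqr_ge0 ?invsqr_ge0//=.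
  have -> : (f / e) ^+ 2 * q ^- 2 = (f / (e * - q)) ^+ 2 by field; rewrite e0 q0.
  have -> : p ^- 2 = (- p)^-1 ^+ 2 by rewrite exprVn sqrrN.
  have [np nq] : 0 < - p /\ 0 < - q by rewrite !oppr_gt0.
  have enq : 0 < e * - q by rewrite mulr_gt0.
  rewrite lerXn2r ?nnegrE ?divr_ge0 ?invr_ge0 ?(ltW np) ?(ltW enq) ?(ltW e2p)//.
  rewrite ler_pdivrMr// ler_pdivlMl// /e /f /p /q -subr_ge0.
  set D := (X in 0 <= X).
  have -> : D = (l2 - l1) * (1 - kappa) by rewrite /D; ring.
  by rewrite mulr_ge0//; lra.
have G x : x != 0 -> 0 < geom n (x ^- 2).
  by move=> x0; rewrite geom_gt0// invr_gt0 exprn_even_gt0.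
have := G _ (lt0r_neq0 e1p); have := G _ (lt0r_neq0 e2p).
have := G _ (ltr0_neq0 r1); have := G _ (ltr0_neq0 r2).
move: (geom n ((1 - l2) ^- 2)) (geom n ((1 - l1) ^- 2)) key.
move: (geom n ((1 - kappa * l1) ^- 2)) (geom n ((1 - kappa * l2) ^- 2)).
move=> Ge1 Ge2 Gr2 Gr1 key Gr2_gt0 Gr1_gt0 Ge2_gt0 Ge1_gt0.
rewrite subr_ge0 subr_gt0 => T1; rewrite -(ltr_pM2r Gr1_gt0).
apply: (@lt_le_trans _ _ ((2 - l1) * Gr1 * Gr2)).
  by rewrite -mulrA -mulrA (mulrC Gr1) ltr_pM2r ?mulr_gt0//; lra.
apply: (@le_trans _ _ ((2 - kappa * l1) * Ge1 * Gr2)); first by rewrite ler_pM2r.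
apply: (@le_trans _ _ ((2 - kappa * l1) * (Gr1 * Ge2))).
  by rewrite -mulrA (mulrC Ge1) ler_pM2l//; lra.
by rewrite -mulrA (mulrC Ge2) ler_pM2r ?mulr_gt0//; lra.
Qed.

(** [Tfun] starts from 0 at [n = 0] with decreasing increments, so once it
    is negative it stays negative. *)
Lemma Tfun_lt0 n k l kappa : kappa < 0 -> 1 < l < 2 -> (n <= k)%N ->
  Tfun n l kappa < 0 -> Tfun k l kappa < 0.
Proof.
move=> kap0 /andP[l1 l2] nk.
have e1 : 1 < 1 - kappa * l by nra.
have [e0 r0] : 1 - kappa * l != 0 /\ 1 - l != 0.
  by split; [rewrite gt_eqF//|rewrite lt_eqF//]; lra.
apply: contraTT; rewrite -!leNgt; elim: k nk => [|k IH].
  by rewrite leqn0 => /eqP ->.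
rewrite leq_eqVlt => /orP[/eqP -> //|]; rewrite ltnS => nk Tk.
apply: IH => //; move: Tk; rewrite !Tfun_geom//.
set Y := _ ^- 2; set X := _ ^- 2.
have Y0 : 0 <= Y by rewrite invr_ge0 sqr_ge0.
have Y1 : Y <= 1 by rewrite invf_le1 ?exprn_gt0 ?exprn_ege1//; lra.
have X1 : 1 <= X.
  by rewrite invf_ge1 ?exprn_even_gt0// -sqrrN exprn_ile1//; lra.
pose t j := (2 - kappa * l) * Y ^+ j - (2 - l) * X ^+ j.
have tE m : (2 - kappa * l) * geom m Y - (2 - l) * geom m X
    = \sum_(1 <= j < m.+1) t j by rewrite /geom !mulr_sumr -sumrB.
rewrite !tE big_nat_recr//=; have [tk _|tk] := leP 0 (t k.+1); last lra.
rewrite big_nat; apply: sumr_ge0 => j /andP[_ jk].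
apply: le_trans tk _; rewrite /t lerB//.
- by apply: ler_wpM2l; [lra|rewrite ler_wiXn2l// ltnW].
- by apply: ler_wpM2l; [lra|rewrite ler_weXn2l// ltnW].
Qed.

(** A value of [get] above 1 cannot be the default 0, so it is a root; left of
    it [Tfun] is negative. *)
Lemma Tfun_lt0_gLbar n l kappa : kappa < 0 -> (0 < n)%N ->
  1 < l < gLbar n kappa -> l < 2 /\ Tfun n l kappa < 0.
Proof.
move=> kap0 n0 /andP[l1 lt_l].
have : [set l : R | 1 < l < 2 /\ Tfun n l kappa = 0] (gLbar n kappa).
  rewrite /gLbar in lt_l *; case: xgetP => [y -> //|no_root].
  move: lt_l; rewrite getPN// => /(lt_trans l1).
  by rewrite ltNge ler01.
case=> /andP[_ g2] Tg; split; first exact: lt_trans g2.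
rewrite ltNge; apply/negP => Tl.
by have := Tfun_gt0 kap0 n0 (_ : 1 < l < _) g2 Tl;
  rewrite Tg ltxx l1 lt_l => /(_ isT).
Qed.

Lemma Nbar_le n l kappa : kappa < 0 -> (0 < n)%N -> 1 < l < gLbar n kappa ->
  (Nbar l kappa <= n)%N.
Proof.
move=> kap0 n0 lg; have [l2 Tn] := Tfun_lt0_gLbar kap0 n0 lg.
have l12 : 1 < l < 2 by case/andP: lg => ->.
rewrite /Nbar /nat_max; case: xgetP => [k -> [Ak _]|_]; last exact: leq0n.
rewrite leqNgt; apply/negP => /ltnW nk.
by have := Tfun_lt0 kap0 l12 nk Tn; rewrite ltNge Ak.
Qed.

End Threshold.
(** * The worst-case function *)

(** The second summand of [Prate] is the mean of the two values of [Efun] with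
    the weights [umass] and [vmass]. *)
Lemma Prate_mass (R : realType) (L mu gamma : R) (N Nb : nat) :
  0 < gamma -> 1 < gamma * L < 2 -> mu < 0 ->
  let rho := 1 - gamma * L in let eta := 1 - gamma * mu in
  Prate L mu gamma N Nb
  = umass rho eta * Efun Nb rho + vmass rho eta * Efun Nb eta
    + (1 + rho) * (1 + eta) / (rho + eta) * (N%:R - Nb%:R).
Proof.
move=> gam0 /andP[gL1 gL2] mu0 rho eta; rewrite /Prate -/rho -/eta.
have rho0 : rho < 0 by rewrite /rho; lra.
have rhoN1 : -1 < rho by rewrite /rho; lra.
have eta1 : 1 < eta by rewrite /eta; nra.
have -> : gamma * L = 1 - rho by rewrite /rho; ring.
have -> : gamma * mu = 1 - eta by rewrite /eta; ring.
have r2 : 1 - rho ^+ 2 != 0 by rewrite gt_eqF//; nra.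
have e2 : 1 - eta ^+ 2 != 0 by rewrite lt_eqF//; nra.
have er2_gt0 : 0 < eta ^+ 2 - rho ^+ 2 by nra.
have er2 : eta ^+ 2 - rho ^+ 2 != 0 by rewrite gt_eqF.
have re : rho + eta != 0 by rewrite gt_eqF//; lra.
rewrite addrC /umass /vmass; move: (Efun _ _) (Efun _ _) => A B.
field; rewrite re er2 e2 r2/= lt_eqF//; lra.
Qed.

Lemma gd_chain (R : realType) (d : nat) (f : 'rV[R]_d -> R) (gamma : R)
    (x : nat -> 'rV[R]_d) (N : nat) :
  (forall k, (k < N)%N -> x k.+1 = x k - gamma *: grad f (x k)) ->
  forall i, (i <= N)%N -> gd f gamma (x 0%N) i = x i.
Proof.
move=> xS; have gdS j : gd f gamma (x 0%N) j.+1
    = gd f gamma (x 0%N) j - gamma *: grad f (gd f gamma (x 0%N) j) by [].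
elim=> [|i IH] iN; first by [].
by rewrite gdS (xS i iN) (IH (ltnW iN)).
Qed.

Lemma bigmin_last (R : realType) (h : nat -> R) (N : nat) (c : R) :
  h N = c -> (forall i, (i <= N)%N -> c <= h i) ->
  \big[Num.min/h 0%N]_(i < N.+1) h i = c.
Proof.
move=> hN hge; apply/eqP; rewrite eq_le; apply/andP; split.
  by rewrite -hN; exact: (bigmin_le _ ord_max).
by apply: le_bigmin => [|i _]; apply: hge; rewrite // -ltnS.
Qed.

Unset Implicit Arguments.

Theorem proposition5p14 (R : realType) (L mu gamma : R) (N : nat)
    (hL : 0 < L) (hmu : mu < 0) (hN : (0 < N)%N) (hgamma : 0 < gamma)
    (hgL : 1 < gamma * L < gLbar N (mu / L)) :
  let P := Prate L mu gamma N (Nbar (gamma * L) (mu / L)) in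
  exists (d : nat) (f : 'rV[R]_d -> R) (x0 : 'rV[R]_d),
    let x := gd f gamma x0 in
    let fstar := inf (range f) in
    let m := \big[Num.min/enorm (grad f (x 0%N)) ^+ 2]_(i < N.+1)
               enorm (grad f (x i)) ^+ 2 in
    [/\ (1 <= d)%N, Fclass mu L f, has_lbound (range f) & fstar < f x0] /\
    (1 / (2 * L) * m = (f x0 - fstar) / (1 + gamma * L * P) /\
     1 / (2 * L) * m = (f x0 - f (x N)) / (gamma * L * P)).
Proof.
have kappa0 : mu / L < 0 by rewrite pmulr_llt0// invr_gt0.
have [gL2 _] := Tfun_lt0_gLbar kappa0 hN hgL.
have NbN := Nbar_le kappa0 hN hgL.
have gL1 : 1 < gamma * L by case/andP: hgL.
move: (Nbar _ _) NbN => Nb NbN P.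
set rho := 1 - gamma * L; set m := - mu; set eta := 1 + gamma * m.
have m0 : 0 < m by rewrite oppr_gt0.
have rho0 : rho < 0 by rewrite subr_lt0.
have rhoN1 : -1 < rho by rewrite /rho; lra.
have eta1 : 1 < eta by rewrite ltrDl mulr_gt0.
pose u k := (frame rho eta N Nb k).1.
pose v k := (frame rho eta N Nb k).2.
pose g k := u k + v k.
pose step k := dot (g k) (g k) + dot (g k) (g k.+1).
pose x k := - (gamma *: \sum_(0 <= j < k) g j).
pose F k := - (gamma / 2 * \sum_(0 <= j < k) step j).
have gS k : g k.+1 = rho *: u k + eta *: v k by exact: frameS.
have xS k : x k.+1 = x k - gamma *: g k.
  by rewrite /x big_nat_recr//= scalerDr opprD.
have FS k : F k.+1 = F k - gamma / 2 * step k.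
  by rewrite /F big_nat_recr//= mulrDr opprD.
have uv0 k l : (k <= l < N)%N -> dot (u k) (v l) = 0.
  by case/andP => kl lN; rewrite frame_orth// kl ltnW.
have uv_ge0 l j : (l < j <= N)%N -> 0 <= \sum_(l <= k < j) dot (u k) (v l).
  exact: frame_uv_sum_ge0.
have interp (i j : 'I_N.+1) z :
    paraboloid mu (x j) (g j) (F j) z <= paraboloid L (x i) (g i) (F i) z.
  rewrite -(opprK mu); apply: (@chain_interpolable _ _ L m gamma N) => //;
    by rewrite -ltnS.
have [f [fF fx fg fU fmax]] := interpolation ord0 interp.
have {}fx i : (i <= N)%N -> f (x i) = F i 
  by rewrite -ltnS => iN; exact: (fx (Ordinal iN)).
have {}fg i : (i <= N)%N -> grad f (x i) = g i 
  by rewrite -ltnS => iN; exact: (fg (Ordinal iN)).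
have gdE i : (i <= N)%N -> gd f gamma (x 0%N) i = x i.
  by apply: gd_chain => k kN; rewrite fg ?xS// ltnW.
have gN1 : dot (g N) (g N) = 1 by apply: frame_norm1; rewrite ?NbN/=.
(* The vertex value of the last upper paraboloid, which is the infimum. *)
pose c := F N - 1 / (2 * L).
have c_le z : c <= f z.
  apply: (fmax (fun=> c)) => [p q t /andP[t0 t1]|i y].
    have -> : t * c + (1 - t) * c = c by ring.
    rewrite lerDl -!mulNr mulr_ge0 ?dot_ge0// mulr_ge0//; last first.
      by rewrite mulr_ge0// subr_ge0.
    by rewrite divr_ge0// ltW.
  rewrite paraboloid_vertex ?gt_eqF//; apply: ler_wpDr.
    by rewrite mulr_ge0 ?dot_ge0// divr_ge0// ltW.
  have iN : (i <= N)%N by rewrite -ltnS.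
  have := top_value_le hL m0 hgamma gS FS uv0 iN.
  by rewrite -/(g N) gN1.
have c_attained : f (x N - L^-1 *: g N) = c.
  apply/eqP; rewrite eq_le c_le andbT.
  apply: le_trans (fU ord_max _) _.
  by rewrite paraboloid_vertex ?gt_eqF// subrr dot0r mulr0 addr0 gN1.
have lbf : has_lbound (range f) by exists c => _ [z _ <-].
have fstarE : inf (range f) = c.
  apply/eqP; rewrite eq_le; apply/andP; split.
    by rewrite -c_attained; apply: ge_inf => //; exists (x N - L^-1 *: g N).
  by apply: lb_le_inf => [|_ [z _ <-]]; [exists (f 0), 0|].
have stepP : \sum_(0 <= j < N) step j = P.
  rewrite /step frame_total// /P Prate_mass ?gL1//.
  by rewrite /eta /m mulrN.
have P0 : 0 < P.
  rewrite -stepP big_ltn//= ltr_pwDl ?frame_decrease_gt0//.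
  rewrite big_nat; apply: sumr_ge0 => k /andP[_ kN].
  by rewrite ltW// frame_decrease_gt0.
have minE : \big[Num.min/enorm (grad f (gd f gamma (x 0%N) 0%N)) ^+ 2]_(i < N.+1)
    enorm (grad f (gd f gamma (x 0%N) i)) ^+ 2 = 1.
  apply: (bigmin_last (h := fun i =>
    enorm (grad f (gd f gamma (x 0%N) i)) ^+ 2)).
    by rewrite enorm_sqr gdE// fg// gN1.
  by move=> i iN; rewrite enorm_sqr gdE// fg//; exact: frame_norm_ge1.
exists N.+2, f, (x 0%N); rewrite /= minE fstarE gdE// !fx//.
have F0 : F 0%N = 0 by rewrite /F big_geq// mulr0 oppr0.
have FN : F N = - (gamma / 2 * P) by rewrite /F stepP.
have L2 : 0 < 1 / (2 * L) by rewrite divr_gt0// mulr_gt0.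
split; first split=> //.
  by rewrite /c F0 FN -opprD oppr_lt0 addr_gt0// !mulr_gt0.
split; rewrite /c F0 FN; field;
  by rewrite ?(gt_eqF hL) ?(gt_eqF hgamma) ?(gt_eqF P0)// gt_eqF// addr_gt0// !mulr_gt0.
Qed.
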